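(* Let $R$ be an $F$-finite regular domain of characteristic $p>0$ and let $e\geq 1$. If $M$ is a (left) $D_{R[t]}^e$-module, then there is a unique decomposition $$M=\bigoplus_{i_1,\ldots,i_e\in\mathbf{F}_p}M_{i_1,\ldots,i_e},$$ where for $1\leq \ell\leq e$ the operator $\theta_{p^{\ell-1}}$ acts on $M_{i_1,\ldots,i_e}$ by multiplication by $-i_{\ell}$. Moreover, each $M_{i_1,\ldots,i_e}$ is a $D_R^e$-module, and every morphism of $D_{R[t]}^e$-modules preserves this decomposition.
   Context: $R$ is $F$-finite if the Frobenius map $u\mapsto u^p$ on $R$ is finite. For $e\ge 0$ let $D_R^e=\mathrm{End}_{R^{p^e}}(R)$ and $D_{R[t]}^e=\mathrm{End}_{R[t]^{p^e}}(R[t])$; the action of an operator $P$ on a ring element $h$ is denoted $P\bullet h$. $D_R^e$ is viewed inside $D_{R[t]}^e$ by acting on coefficients. The operators $\partial_t^{[m]}$ are $R$-linear with $\partial_t^{[m]}\bullet t^r=\binom{r}{m}t^{r-m}$ ($\binom{r}{m}=0$ if $r<m$), and $\partial_t^{[m]}\in D_{R[t]}^e$ if $m<p^e$. Put $\theta_m=\partial_t^{[m]}t^m\in D_{R[t]}^e$ for $m<p^e$ (composition: multiply by $t^m$, then apply $\partial_t^{[m]}$). A morphism $\phi\colon M\to N$ preserves the decomposition if $\phi(M_{i_1,\ldots,i_e})\subseteq N_{i_1,\ldots,i_e}$ for all indices. *)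

(* Defs.v *)
From HB Require Import structures.
From mathcomp Require Import all_boot all_order all_algebra.
From mathcomp Require Import boolp.
Set Implicit Arguments.
Unset Strict Implicit.
Unset Printing Implicit Defensive.
Import GRing.Theory.
Local Open Scope ring_scope.

(* Ideals are boolean predicates, as in ring_quotient: [idealr_closed I] says  *)
(* that I is a proper ideal. With the axioms of boolp every subset of a ring   *)
(* is given by such a predicate.                                               *)

Section Regular.
Variable A : comNzRingType.
Implicit Types I J m : {pred A}.

Definition generates I n (x : 'I_n -> A) : Prop :=
  forall y, y \in I <-> exists c : 'I_n -> A, y = \sum_i c i * x i.

(* The improper ideal is generated by 1. *)
Definition noetherian_ring : Prop :=
  forall I, idealr_closed I -> exists n (x : 'I_n -> A), generates I x.

Definition prime_ideal I : Prop := idealr_closed I /\ prime_idealr_closed I.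

Definition maximal_ideal m : Prop :=
  idealr_closed m /\
  forall J, idealr_closed J -> {subset m <= J} -> {subset J <= m}.

Definition prime_chain n (P : nat -> {pred A}) : Prop :=
  (forall i, (i <= n)%N -> prime_ideal (P i)) /\
  (forall i, (i < n)%N ->
     {subset P i <= P i.+1} /\ exists2 x, x \in P i.+1 & x \notin P i).

Definition krull_dim_is d : Prop :=
  (exists P, prime_chain d P) /\
  (forall n P, prime_chain n P -> (n <= d)%N).

Definition regular_local_ring : Prop :=
  noetherian_ring /\
  exists m, [/\ maximal_ideal m,
                forall m', maximal_ideal m' -> m' =i m
              & exists d (x : 'I_d -> A), krull_dim_is d /\ generates m x].

End Regular.

Arguments noetherian_ring A : clear implicits.
Arguments regular_local_ring A : clear implicits.

Section Localization.
Variables (R : idomainType) (P : prime_idealr R).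

Definition localization_pred : {pred {fraction R}} := fun x =>
  `[< exists a s : R, s \notin (P : {pred R}) /\
        x = FracField.tofrac a / FracField.tofrac s >].

Fact localization_subring_closed : subring_closed localization_pred.
Proof.
have P0 s : s \notin (P : {pred R}) -> FracField.tofrac s != 0.
  by apply: contra; rewrite tofrac_eq0 => /eqP ->; rewrite idealr0.
have PM s t : s \notin (P : {pred R}) -> t \notin (P : {pred R}) ->
    s * t \notin (P : {pred R}).
  by move=> sP tP; rewrite prime_idealrM negb_or sP.
split.
- by apply/asboolP; exists 1, 1; rewrite idealr1 rmorph1 divr1.
- move=> _ _ /asboolP[a [s [sP ->]]] /asboolP[b [t [tP ->]]].
  apply/asboolP; exists (a * t - b * s), (s * t); split; first exact: PM.
  by rewrite -mulNr addf_div ?P0// rmorphB !rmorphM/= mulNr.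
- move=> _ _ /asboolP[a [s [sP ->]]] /asboolP[b [t [tP ->]]].
  apply/asboolP; exists (a * b), (s * t); split; first exact: PM.
  by rewrite !rmorphM/= mulf_div.
Qed.

HB.instance Definition _ :=
  GRing.isSubringClosed.Build _ localization_pred localization_subring_closed.

(* R_P, as a subring of the fraction field of the domain R. *)
Record localization := Localization {
  localization_val : {fraction R};
  _ : localization_val \in localization_pred }.

HB.instance Definition _ := [isSub for localization_val].
HB.instance Definition _ := [Choice of localization by <:].
HB.instance Definition _ := [SubChoice_isSubComNzRing of localization by <:].

End Localization.

Definition regular_domain (R : idomainType) : Prop :=
  noetherian_ring R /\
  forall P : prime_idealr R, regular_local_ring (localization P).

Definition F_finite (R : comNzRingType) p (charRp : p \in [pchar R]) : Prop :=
  exists n (x : 'I_n -> R), forall y, exists c : 'I_n -> R,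
    y = \sum_i pFrobenius_aut charRp (c i) * x i.

Section DiffOp.
Variables (p e : nat) (S : comNzRingType).

Definition frob_linear (P : S -> S) : Prop :=
  (forall x y, P (x + y) = P x + P y) /\
  (forall a x, P (a ^+ (p ^ e) * x) = a ^+ (p ^ e) * P x).

(* D_S^e = End_{S^{p^e}}(S). *)
Record diffop := DiffOp { act : S -> S; act_frob_linear : frob_linear act }.

HB.instance Definition _ := gen_eqMixin diffop.
HB.instance Definition _ := gen_choiceMixin diffop.

Lemma actD (P : diffop) x y : act P (x + y) = act P x + act P y.
Proof. by case: P => P []. Qed.

Lemma actX (P : diffop) a x :
  act P (a ^+ (p ^ e) * x) = a ^+ (p ^ e) * act P x.
Proof. by case: P => P []. Qed.

Lemma act0 (P : diffop) : act P 0 = 0.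
Proof. by apply: (addrI (act P 0)); rewrite -actD !addr0. Qed.

Lemma diffopP (P Q : diffop) : (forall x, act P x = act Q x) -> P = Q.
Proof.
case: P Q => [P hP] [Q hQ] /= /funext PQ.
by case: _ / PQ hQ => hQ; congr DiffOp; exact: Prop_irrelevance.
Qed.

Fact diffop_zero_subproof : frob_linear (fun=> 0).
Proof. by split=> *; rewrite ?addr0 ?mulr0. Qed.

Fact diffop_opp_subproof (P : diffop) : frob_linear (fun x => - act P x).
Proof. by split=> *; rewrite ?actD ?actX ?opprD ?mulrN. Qed.

Fact diffop_add_subproof (P Q : diffop) :
  frob_linear (fun x => act P x + act Q x).
Proof. by split=> *; rewrite ?actD ?actX ?mulrDr// addrACA. Qed.

Fact diffop_one_subproof : frob_linear id.
Proof. by []. Qed.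

Fact diffop_mul_subproof (P Q : diffop) :
  frob_linear (fun x => act P (act Q x)).
Proof. by split=> *; rewrite ?actD ?actX. Qed.

Definition diffop_zero := DiffOp diffop_zero_subproof.
Definition diffop_opp P := DiffOp (diffop_opp_subproof P).
Definition diffop_add P Q := DiffOp (diffop_add_subproof P Q).
Definition diffop_one := DiffOp diffop_one_subproof.
Definition diffop_mul P Q := DiffOp (diffop_mul_subproof P Q).

Fact diffop_addA : associative diffop_add.
Proof. by move=> P Q T; apply: diffopP => x /=; rewrite addrA. Qed.
Fact diffop_addC : commutative diffop_add.
Proof. by move=> P Q; apply: diffopP => x /=; rewrite addrC. Qed.
Fact diffop_add0 : left_id diffop_zero diffop_add.
Proof. by move=> P; apply: diffopP => x /=; rewrite add0r. Qed.
Fact diffop_addN : left_inverse diffop_zero diffop_opp diffop_add.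
Proof. by move=> P; apply: diffopP => x /=; rewrite addNr. Qed.

HB.instance Definition _ :=
  GRing.isZmodule.Build diffop
    diffop_addA diffop_addC diffop_add0 diffop_addN.

Fact diffop_mulA : associative diffop_mul.
Proof. by move=> P Q T; apply: diffopP. Qed.
Fact diffop_mul1l : left_id diffop_one diffop_mul.
Proof. by move=> P; apply: diffopP. Qed.
Fact diffop_mul1r : right_id diffop_one diffop_mul.
Proof. by move=> P; apply: diffopP. Qed.
Fact diffop_mulDl : left_distributive diffop_mul +%R.
Proof. by move=> P Q T; apply: diffopP. Qed.
Fact diffop_mulDr : right_distributive diffop_mul +%R.
Proof. by move=> P Q T; apply: diffopP => x; rewrite /= actD. Qed.
Fact diffop_one_neq0 : diffop_one != 0.
Proof.
apply/eqP => /(congr1 (fun P => act P 1)) /= /eqP.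
by rewrite oner_eq0.
Qed.

HB.instance Definition _ :=
  GRing.Zmodule_isNzRing.Build diffop diffop_mulA diffop_mul1l diffop_mul1r
    diffop_mulDl diffop_mulDr diffop_one_neq0.

Lemma actB (P Q : diffop) x : act (P - Q) x = act P x - act Q x.
Proof. by []. Qed.

Lemma actM (P Q : diffop) x : act (P * Q) x = act P (act Q x).
Proof. by []. Qed.

Fact mulop_subproof (f : S) : frob_linear (fun x => f * x).
Proof. by split=> *; rewrite ?mulrDr// mulrCA. Qed.

Definition mulop f : diffop := DiffOp (mulop_subproof f).

End DiffOp.

Section Theta.
Variables (p e : nat) (R : comNzRingType) (charRp : p \in [pchar R]).

Let charPp : p \in [pchar {poly R}].
Proof. by rewrite pchar_poly. Qed.

Lemma powD (a b : {poly R}) :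
  (a + b) ^+ (p ^ e) = a ^+ (p ^ e) + b ^+ (p ^ e).
Proof. by rewrite (exprDn_pchar a b) // pnatX pnatE ?(pcharf_prime charRp)// charPp. Qed.

(* An additive map commuting with multiplication by t^{p^e} and by the p^e-th  *)
(* powers of constants is R[t]^{p^e}-linear.                                   *)
Lemma frob_linear_poly (f : {poly R} -> {poly R}) :
  (forall g h, f (g + h) = f g + f h) ->
  (forall c g, f ((c ^+ (p ^ e))%:P * g) = (c ^+ (p ^ e))%:P * f g) ->
  (forall g, f ('X^(p ^ e) * g) = 'X^(p ^ e) * f g) ->
  frob_linear p e f.
Proof.
move=> fD fC fX; split=> // a; elim/poly_ind: a => [|a c IHa] g.
  have p0 : (0 < p ^ e)%N by rewrite expn_gt0 prime_gt0 ?(pcharf_prime charRp).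
  rewrite expr0n (gtn_eqF p0) /= mul0r mul0r.
  by apply: (addrI (f 0)); rewrite -fD !addr0.
rewrite powD exprMn -polyC_exp !mulrDl fD fC -!mulrA.
by rewrite IHa fX.
Qed.

Fact nderivn_frob_linear m : (m < p ^ e)%N ->
  frob_linear p e (fun f : {poly R} => f^`N(m)).
Proof.
move=> hm; apply: frob_linear_poly => [g h|c g|g].
- exact: nderivnD.
- by rewrite mul_polyC nderivnZ mul_polyC.
have pp := pcharf_prime charRp.
have binq k : (0 < k < p ^ e)%N -> 'C(p ^ e, k)%:R = 0 :> R.
  move=> /andP[k0 kq].
  apply/eqP; rewrite -(dvdn_pcharf charRp).
  have : ('X + 1 : {poly R}) ^+ (p ^ e) = 'X^(p ^ e) + 1.
    by rewrite powD expr1n.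
  move=> /(congr1 (fun q : {poly R} => q`_k)).
  rewrite exprDn coef_sum /= coefD coefXn coef1 (ltn_eqF kq) (gtn_eqF k0) addr0.
  have kle : (p ^ e - k < (p ^ e).+1)%N by rewrite ltnS leq_subr.
  rewrite (bigD1 (Ordinal kle)) //= big1 ?addr0; last first.
    move=> i /eqP ik; rewrite expr1n mulr1 coefMn coefXn.
    case: eqP => [ki|]; last by rewrite mul0rn.
    case: ik; apply: val_inj => /=; rewrite ki subKn //.
    by rewrite -ltnS.
  rewrite expr1n mulr1 coefMn coefXn subKn ?(ltnW kq)// eqxx.
  by rewrite bin_sub ?(ltnW kq)// => /eqP; rewrite -(dvdn_pcharf charRp).
apply/polyP => i; rewrite coef_nderivn !(mulrC 'X^(p ^ e)) !coefMXn.
have [iq|qi] := ltnP i (p ^ e).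
- case: ltnP => [|qmi]; first by rewrite mul0rn.
  have -> : (m + i = p ^ e + (m + i - p ^ e))%N by rewrite subnKC.
  set j := (m + i - p ^ e)%N.
  have jm : (j < m)%N.
    by rewrite /j ltn_subLR // addnC ltn_add2r.
  rewrite -binomial.Vandermonde -mulr_natr natr_sum big1 ?mulr0// => k _.
  case: (posnP k) => [->|k0]; first by rewrite subn0 (bin_small jm) muln0.
  by rewrite natrM binq ?mul0r// k0 /= (leq_ltn_trans _ hm)// -ltnS.
- rewrite ltnNge (leq_trans qi (leq_addl _ _)) /= coef_nderivn.
  rewrite addnBA // -mulr_natr -[RHS]mulr_natr; congr (_ * _).
  have -> : (m + i = p ^ e + (m + i - p ^ e))%N.
    by rewrite subnKC// (leq_trans qi (leq_addl _ _)).
  rewrite -binomial.Vandermonde natr_sum big_ord_recl /= bin0 mul1n subn0 addKn.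
  rewrite big1 ?addr0// => k _.
  by rewrite natrM binq ?mul0r//= (leq_ltn_trans _ hm).
Qed.

Definition partial_t m (hm : (m < p ^ e)%N) : diffop p e {poly R} :=
  DiffOp (nderivn_frob_linear hm).

Definition theta m (hm : (m < p ^ e)%N) : diffop p e {poly R} :=
  partial_t hm * mulop p e 'X^m.

Lemma expn_lt_ord (l : 'I_e) : (p ^ l < p ^ e)%N.
Proof. by rewrite ltn_exp2l ?prime_gt1 ?(pcharf_prime charRp). Qed.

Fact coef_op_subproof (P : diffop p e R) : frob_linear p e (map_poly (act P)).
Proof.
apply: frob_linear_poly => [g h|c g|g]; apply/polyP => i.
- by rewrite coefD !(coef_map_id0 _ _ (act0 P)) coefD actD.
- by rewrite coefCM !(coef_map_id0 _ _ (act0 P)) coefCM actX.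
- rewrite coefXnM !(coef_map_id0 _ _ (act0 P)) coefXnM.
  by case: ifP => // _; rewrite act0.
Qed.

(* D_R^e inside D_{R[t]}^e: an operator on R acts on coefficients. *)
Definition coef_op (P : diffop p e R) : diffop p e {poly R} :=
  DiffOp (coef_op_subproof P).

Lemma act_coef_op P (f : {poly R}) i : (act (coef_op P) f)`_i = act P f`_i.
Proof. by rewrite /= (coef_map_id0 _ _ (act0 P)). Qed.

Fact coef_op_zmod_morphism : zmod_morphism coef_op.
Proof.
move=> P Q; apply: diffopP => f; apply/polyP => i.
by rewrite actB coefB !act_coef_op actB.
Qed.

Fact coef_op_monoid_morphism : monoid_morphism coef_op.
Proof.
split=> [|P Q]; apply: diffopP => f; apply/polyP => i.
  by rewrite act_coef_op /=.
by rewrite actM !act_coef_op actM.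
Qed.

HB.instance Definition _ :=
  GRing.isZmodMorphism.Build _ _ coef_op coef_op_zmod_morphism.
HB.instance Definition _ :=
  GRing.isMonoidMorphism.Build _ _ coef_op coef_op_monoid_morphism.

Lemma coef_op_inj : injective coef_op.
Proof.
move=> P Q PQ; apply: diffopP => x.
by have := congr1 (fun T => (act T x%:P)`_0) PQ; rewrite !act_coef_op coefC.
Qed.

End Theta.

Section Decomposition.
Variables (p e : nat) (R : comNzRingType) (charRp : p \in [pchar R]).

(* The component [i l] is i_{l+1} of the usual numbering 1, ..., e. *)
Definition multi_index := {ffun 'I_e -> 'F_p}.

Variable M : lmodType (diffop p e {poly R}).

(* M is the internal direct sum of the additive subgroups F i. *)
Definition direct_sum_decomposition (F : multi_index -> {pred M}) : Prop :=
  (forall i, zmod_closed (F i)) /\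
  (forall x : M, exists! y : {ffun multi_index -> M},
     (forall i, y i \in F i) /\ x = \sum_i y i).

Definition theta_decomposition (F : multi_index -> {pred M}) : Prop :=
  direct_sum_decomposition F /\
  (forall (i : multi_index) (l : 'I_e) (x : M), x \in F i ->
     theta charRp (expn_lt_ord charRp l) *: x = (- (i l : nat)%:R) *: x).

Definition DR_submodule (U : {pred M}) : Prop :=
  zmod_closed U /\
  (forall (P : diffop p e R) (x : M), x \in U -> coef_op charRp P *: x \in U).

End Decomposition.

(* Main.v *)
Require Import Defs.
From mathcomp Require Import all_boot all_order all_algebra.
From mathcomp Require Import boolp.
Set Implicit Arguments.
Unset Strict Implicit.
Unset Printing Implicit Defensive.
Import GRing.Theory.
Local Open Scope ring_scope.

(* The operators theta_{p^l} are diagonal in the basis (t^r): theta_m          *)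
(* multiplies t^r by binom(m + r, m).  Sorting the monomials t^r by the tuple  *)
(* of their eigenvalues gives orthogonal idempotents of D_{R[t]}^e with sum 1  *)
(* that commute with D_R^e.  Any decomposition as in the theorem has to be     *)
(* the decomposition by these idempotents, because distinct tuples of          *)
(* eigenvalues differ by a unit of F_p in some place.                          *)

(** The projections [theta_proj i] onto the monomials of index [i] are $R[t]^{p^e}$-linear because
    the eigenvalue tuples are periodic in $r$ with period $p^e$ ([theta_index_addX]). Being elements
    of the operator ring, they act on every module, and [theta_projM] and [theta_proj_sum] split it
    into their images. Coefficientwise operators commute with them ([theta_proj_coef_op]), and so
    does every linear map, so both preserve the pieces. For uniqueness, [theta_eigen_component] puts
    each joint eigenvector into the piece of its tuple. *)

Lemma natr_eq_Fp p (A : nzRingType) m n :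
  p \in [pchar A] -> m%:R = n%:R :> 'F_p -> m%:R = n%:R :> A.
Proof.
move=> charA /(congr1 val); rewrite /= !val_Fp_nat ?(pcharf_prime charA)//.
move=> mn.
by rewrite -(GRing.natr_mod_pchar charA m) mn GRing.natr_mod_pchar.
Qed.

Lemma scaler_natr_inj_Fp p (A : nzRingType) (V : lmodType A) (a b : 'F_p)
    (x : V) :
  p \in [pchar A] -> a != b -> (a : nat)%:R *: x = (b : nat)%:R *: x -> x = 0.
Proof.
move=> charA; rewrite -subr_eq0 -unitfE => abU abx.
pose c := (a - b)^-1.
(* Written without subtraction, $c(a-b)=1$ is an identity between images of naturals, so
   [natr_eq_Fp] carries it to [A]. *)
have : (c * a : nat)%:R = (1 + c * b : nat)%:R :> 'F_p.
  rewrite natrD !natrM !natr_Zp; apply/eqP; rewrite -subr_eq -mulrBr.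
  by rewrite mulVr.
move=> /(natr_eq_Fp charA) /(congr1 (fun u => u *: x)).
rewrite natrD scalerDl !natrM -!scalerA abx scale1r => /eqP.
by rewrite -[X in X == _]add0r (inj_eq (addIr _)) => /eqP.
Qed.

Section ThetaCoef.
Variables (p e : nat) (R : comNzRingType) (charRp : p \in [pchar R]).

Local Notation D := (diffop p e {poly R}).

Lemma act_natr n (f : {poly R}) : act (n%:R : D) f = f *+ n.
Proof. by elim: n => [//|n IHn]; rewrite !mulrS -IHn. Qed.

Lemma pchar_diffop : p \in [pchar D].
Proof.
apply/andP; split; first exact: (pcharf_prime charRp).
apply/eqP/diffopP => f; rewrite act_natr.
by apply/polyP => i; rewrite coefMn coef0 GRing.mulrn_pchar.
Qed.

Lemma coef_act_theta m (hm : (m < p ^ e)%N) (f : {poly R}) r :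
  (act (theta charRp hm) f)`_r = f`_r *+ 'C(m + r, m).
Proof. by rewrite actM /= coef_nderivn coefXnM ltnNge leq_addr addKn. Qed.

End ThetaCoef.

Section ThetaProj.
Variables (p e : nat) (R : comNzRingType) (charRp : p \in [pchar R]).
Let pp : prime p := pcharf_prime charRp.

Local Notation D := (diffop p e {poly R}).

(* The index of the component containing t^r. *)
Definition theta_index (r : nat) : multi_index p e :=
  [ffun l : 'I_e => - ('C(p ^ l + r, p ^ l))%:R].

(* theta over F_p commutes with t^{p^e}; comparing the coefficients of its     *)
(* values at t^{p^e + r} and t^r gives the congruence of binomials.            *)
Lemma theta_index_addX r : theta_index (p ^ e + r) = theta_index r.
Proof.
apply/ffunP => l; rewrite !ffunE; congr (- _).
have := @actX p e _ (theta (pchar_Fp pp) (expn_lt_ord (pchar_Fp pp) l)) 'X 'X^r.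
move=> /(congr1 (fun f : {poly 'F_p} => f`_(p ^ e + r))).
rewrite coef_act_theta -exprD coefXn eqxx coefXnM ltnNge leq_addr addKn.
by rewrite coef_act_theta coefXn eqxx.
Qed.

Definition theta_proj_fun (i : multi_index p e) (f : {poly R}) : {poly R} :=
  \poly_(r < size f) (f`_r *+ (theta_index r == i)).

Lemma coef_theta_proj_fun i f r :
  (theta_proj_fun i f)`_r = f`_r *+ (theta_index r == i).
Proof.
by rewrite coef_poly; case: ltnP => // /leq_sizeP ->; rewrite ?mul0rn.
Qed.

(** Multiplication by $t^{p^e}$ shifts degrees by $p^e$, which does not change the index of a
    monomial. *)
Fact theta_proj_subproof i : frob_linear p e (theta_proj_fun i).
Proof.
apply: (frob_linear_poly charRp) => [g h|c g|g]; apply/polyP => r.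
- by rewrite coefD !coef_theta_proj_fun coefD mulrnDl.
- by rewrite coefCM !coef_theta_proj_fun coefCM mulrnAr.
- rewrite coefXnM !coef_theta_proj_fun coefXnM.
  have [_|le_r] := ltnP r (p ^ e); first by rewrite mul0rn.
  by rewrite -{2}(subnKC le_r) theta_index_addX.
Qed.

Definition theta_proj i : D := DiffOp (theta_proj_subproof i).

Lemma coef_theta_proj i f r :
  (act (theta_proj i) f)`_r = f`_r *+ (theta_index r == i).
Proof. exact: coef_theta_proj_fun. Qed.

Lemma theta_projM i j : theta_proj i * theta_proj j = theta_proj i *+ (i == j).
Proof.
apply: diffopP => f; apply/polyP => r; rewrite actM !coef_theta_proj.
have [<-|neq_ij] := eqVneq i j.
  by rewrite [theta_proj i *+ _]mulr1n coef_theta_proj; case: eqP.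
rewrite mulr0n coef0; have [->|_] := eqVneq (theta_index r) i.
  by rewrite (negbTE neq_ij) mul0rn.
by rewrite mulr0n.
Qed.

Lemma theta_proj_sum : \sum_i theta_proj i = 1.
Proof.
apply: diffopP => f; apply/polyP => r.
have -> : act (\sum_i theta_proj i) f = \sum_i act (theta_proj i) f.
  by apply: (big_morph (fun P : D => act P f)).
rewrite coef_sum (bigD1 (theta_index r)) //= coef_theta_proj eqxx big1 ?addr0//.
by move=> i ne; rewrite coef_theta_proj eq_sym (negbTE ne).
Qed.

Lemma theta_proj_theta i l :
  theta_proj i * theta charRp (expn_lt_ord charRp l) =
    theta charRp (expn_lt_ord charRp l) * theta_proj i.
Proof.
apply: diffopP => f; apply/polyP => r.
rewrite actM [in RHS]actM coef_theta_proj !coef_act_theta coef_theta_proj.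
by rewrite mulrnAC.
Qed.

Lemma theta_proj_eigen i (l : 'I_e) :
  theta charRp (expn_lt_ord charRp l) * theta_proj i =
    - (i l : nat)%:R * theta_proj i.
Proof.
apply/eqP; rewrite mulNr -addr_eq0; apply/eqP/diffopP => f; apply/polyP => r.
have -> (P Q : D) : act (P + Q) f = act P f + act Q f by [].
rewrite coefD !(actM _ (theta_proj i)) act_natr coefMn coef_act_theta.
rewrite coef_theta_proj coef0 -mulrnDr.
have [<-|_] := eqVneq (theta_index r) i; last by rewrite mul0rn.
(* On a surviving monomial, the binomial plus $i_l$ vanishes in $\mathbf{F}_p$ by the sign in
   [theta_index], hence in [R]. *)
rewrite mulr1n -mulr_natr (natr_eq_Fp (n := 0) charRp) ?mulr0//.
by rewrite natrD natr_Zp ffunE addrN.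
Qed.

Lemma theta_proj_coef_op i (P : diffop p e R) :
  theta_proj i * coef_op charRp P = coef_op charRp P * theta_proj i.
Proof.
apply: diffopP => f; apply/polyP => r.
rewrite !actM coef_theta_proj !act_coef_op coef_theta_proj.
by case: eqP => _; rewrite ?mulr1n// mulr0n act0.
Qed.

Section Module.
Variable M : lmodType D.

(** The image of an idempotent, encoded as its fixed points to get a boolean predicate. *)
Definition theta_component i : {pred M} := fun x => theta_proj i *: x == x.

Lemma theta_projZ i j (x : M) :
  theta_proj i *: (theta_proj j *: x) = (theta_proj i *: x) *+ (i == j).
Proof. by rewrite scalerA theta_projM scalerMnl. Qed.

Lemma theta_proj_component i j (x : M) :
  x \in theta_component j -> theta_proj i *: x = x *+ (i == j).
Proof.
move=> /eqP xj; rewrite -{1}xj theta_projZ.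
by case: eqP => [->|_]; rewrite ?mulr0n// !mulr1n.
Qed.

Lemma theta_component_decomposition :
  theta_decomposition charRp theta_component.
Proof.
split; last first.
  by move=> i l x /eqP xi; rewrite -{1 2}xi !scalerA theta_proj_eigen.
split=> [i|x].
  split=> [|x y /eqP xi /eqP yi]; first by apply/eqP; rewrite scaler0.
  by apply/eqP; rewrite scalerBr xi yi.
exists [ffun i => theta_proj i *: x]; split=> [|y [yF ->]].
  split=> [i|]; first by rewrite ffunE; apply/eqP; rewrite theta_projZ eqxx.
  under eq_bigr do rewrite ffunE.
  by rewrite -scaler_suml theta_proj_sum scale1r.
(* The summands are forced: [theta_proj i] kills every [y j] with [j] other than [i] and fixes
   [y i]. *)
apply/ffunP => i; rewrite ffunE scaler_sumr (bigD1 i)//= big1 ?addr0 => [|j ne].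
  by rewrite (theta_proj_component _ (yF i)) eqxx.
by rewrite (theta_proj_component _ (yF j)) eq_sym (negbTE ne).
Qed.

(** If [k] differs from [i] at [l], then [theta_proj k *: x] is an eigenvector of the [l]-th theta
    for both $-k_l$ and $-i_l$, so it is zero; only the summand for [i] remains in $x = 1 \cdot
    x$. *)
Lemma theta_eigen_component (i : multi_index p e) (x : M) :
  (forall l : 'I_e, theta charRp (expn_lt_ord charRp l) *: x =
     (- (i l : nat)%:R) *: x) -> x \in theta_component i.
Proof.
move=> xE; apply/eqP; rewrite -[RHS]scale1r -theta_proj_sum scaler_suml.
rewrite (bigD1 i) //= big1 ?addr0// => k neq_ki.
have /existsP[l neq_kil] : [exists l, k l != i l].
  apply: contraNT neq_ki => /existsPn eq_ki; apply/eqP/ffunP => l.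
  by apply/eqP/negPn.
apply: (scaler_natr_inj_Fp (pchar_diffop e charRp) neq_kil).
have comm_nat n : theta_proj k * n%:R = n%:R * theta_proj k.
  by rewrite mulr_natr mulr_natl.
apply: oppr_inj; rewrite -!scaleNr scalerA -theta_proj_eigen -theta_proj_theta.
by rewrite -scalerA xE !scalerA mulrN comm_nat mulNr.
Qed.

(** Each [F i] lies in [theta_component i] by its eigenvalues. Conversely, applying [theta_proj i]
    to the [F]-expansion of a fixed point leaves only its [i]-th summand. *)
Lemma theta_decomposition_unique (F : multi_index p e -> {pred M}) :
  theta_decomposition charRp F -> F = theta_component.
Proof.
case=> [[_ Fsum] Feig].
have sub i x : x \in F i -> x \in theta_component i.
  by move=> xi; apply: theta_eigen_component => l; exact: Feig.
apply/funext => i; apply/funext => x; apply/idP/idP => [/sub//|xi].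
have [y [[yF x_y] _]] := Fsum x; suff -> : x = y i by exact: yF.
rewrite -(eqP xi) x_y scaler_sumr (bigD1 i)//= big1 ?addr0 => [|j ne].
  by rewrite (theta_proj_component _ (sub _ _ (yF i))) eqxx.
by rewrite (theta_proj_component _ (sub _ _ (yF j))) eq_sym (negbTE ne).
Qed.

Lemma theta_component_DR_submodule i : DR_submodule charRp (theta_component i).
Proof.
split; first by case: theta_component_decomposition => -[].
move=> P x /eqP xi; apply/eqP.
by rewrite scalerA theta_proj_coef_op -scalerA xi.
Qed.

End Module.

End ThetaProj.

Theorem proposition4p2 (p e : nat) (R : idomainType)
    (charRp : p \in [pchar R]) (he : (1 <= e)%N)
    (finR : F_finite charRp) (regR : regular_domain R)
    (M : lmodType (diffop p e {poly R})) :
  [/\ exists! F : multi_index p e -> {pred M}, theta_decomposition charRp F,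
      forall F : multi_index p e -> {pred M}, theta_decomposition charRp F ->
        forall i, DR_submodule charRp (F i)
    & forall (N : lmodType (diffop p e {poly R})) (phi : {linear M -> N})
        (F : multi_index p e -> {pred M}) (G : multi_index p e -> {pred N}),
        theta_decomposition charRp F -> theta_decomposition charRp G ->
        forall i x, x \in F i -> phi x \in G i].
Proof.
split.
- exists (theta_component charRp (M := M)); split.
    exact: theta_component_decomposition.
  by move=> F /theta_decomposition_unique ->.
- move=> F /theta_decomposition_unique -> i.
  exact: theta_component_DR_submodule.
(* Both decompositions are now given by fixed points of [theta_proj i], a scalar that commutes with
   [phi]. *)
- move=> N phi F G /theta_decomposition_unique -> /theta_decomposition_unique ->.
  by move=> i x /eqP xi; apply/eqP; rewrite -linearZ xi.
Qed.
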